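(* There is a (dynamic programming) algorithm which, given a piecewise-constant function $f : \mathcal{I} \to \mathbb{R}$ on an interval $\mathcal{I} \subseteq \mathbb{R}$, specified by a partition $[a_1, a_2), [a_2, a_3), \dots, [a_t, a_{t+1})$ of $\mathcal{I}$ and values $c_1, \dots, c_t \in \mathbb{R}$ such that $f(r) = c_i$ for all $r \in [a_i, a_{i+1})$, and given an integer $k \geq 1$, returns a piecewise-constant function $g$ on $\mathcal{I}$ with at most $k$ pieces such that $\|f - g\|_\infty$ is minimized among all piecewise-constant functions on $\mathcal{I}$ with at most $k$ pieces. The algorithm runs in $O(k t^2)$ time.
   Context: A function on the interval $\mathcal{I} = [a_1, a_{t+1})$ is piecewise-constant with at most $k$ pieces if $\mathcal{I}$ can be partitioned into at most $k$ intervals on each of which the function is constant. $\|f - g\|_\infty = \sup_{r \in \mathcal{I}} |f(r) - g(r)|$. Running time counts elementary operations (arithmetic operations and comparisons on real numbers, each at unit cost). *)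

(* Defs.v *)
From HB Require Import structures.
From mathcomp Require Import all_boot all_order all_algebra.
From mathcomp Require Import boolp classical_sets set_interval reals.

Set Implicit Arguments.
Unset Strict Implicit.
Unset Printing Implicit Defensive.

Import Order.TTheory GRing.Theory Num.Theory.

Local Open Scope classical_set_scope.
Local Open Scope ring_scope.

(** * Piecewise-constant functions

    Functions on an interval [I] are total functions [R -> R] of which only the
    values on [I] matter. *)

(* The pieces are nonempty intervals of any kind (open, closed, half-open or
   reduced to a point). *)
Definition piecewise_constant (R : realType) (I : set R) (k : nat)
    (g : R -> R) : Prop :=
  exists (m : nat) (J : 'I_m -> interval R),
    [/\ (m <= k)%N,
        partition [set: 'I_m] (fun i => [set` J i]) I &
        forall i, exists v, forall r, r \in J i -> g r = v].

(* On a nonempty [I] this is the true supremum as soon as [f - g] is bounded on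
   [I], in particular when [f] and [g] are piecewise constant. *)
Definition supdist (R : realType) (I : set R) (f g : R -> R) : R :=
  sup [set `|f r - g r| | r in I].

(* [a] lists the endpoints a_1 < ... < a_(t+1) and [c] the values c_1, ..., c_t;
   both are indexed from 0 here. *)
Definition specifies (R : realType) (a c : seq R) (f : R -> R) : Prop :=
  [/\ (0 < size c)%N, size a = (size c).+1, sorted <%R a &
      forall i, (i < size c)%N ->
        forall r, a`_i <= r < a`_i.+1 -> f r = c`_i].

Definition domain (R : realType) (a : seq R) : set R :=
  [set` `[head 0 a, last 0 a[ ].

(** * A real RAM

    The memory consists of countably many arrays of natural numbers, used for
    counters and indices, and countably many arrays of real numbers; a scalar
    variable is a one-cell array. Real numbers can be added, subtracted,
    multiplied, divided and compared, but not converted to natural numbers, and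
    the only real constants are the natural numbers. A program is a finite
    piece of syntax which mentions neither the input nor its size. *)

Inductive nexp : Type :=
| NConst of nat
| NRead of nat & nexp  (* array, index *)
| NAdd of nexp & nexp
| NSub of nexp & nexp  (* truncated *)
| NMul of nexp & nexp.

Inductive rexp : Type :=
| RConst of nat
| RRead of nat & nexp  (* array, index *)
| RAdd of rexp & rexp
| RSub of rexp & rexp
| RMul of rexp & rexp
| RDiv of rexp & rexp.  (* x / 0 is 0 *)

Inductive bexp : Type :=
| BNLe of nexp & nexp
| BNLt of nexp & nexp
| BRLe of rexp & rexp
| BRLt of rexp & rexp
| BNot of bexp
| BAnd of bexp & bexp.

Inductive cmd : Type :=
| CSkip
| CNWrite of nat & nexp & nexp  (* array, index, value *)
| CRWrite of nat & nexp & rexp  (* array, index, value *)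
| CSeq of cmd & cmd
| CIf of bexp & cmd & cmd
| CWhile of bexp & cmd.

Record state (R : realType) : Type := State {
  nmem : nat -> nat -> nat;
  rmem : nat -> nat -> R
}.

Definition upd (T : Type) (m : nat -> nat -> T) (A i : nat) (v : T) :
    nat -> nat -> T :=
  fun B j => if (B == A) && (j == i) then v else m B j.

Fixpoint neval (R : realType) (s : state R) (e : nexp) : nat :=
  match e with
  | NConst n => n
  | NRead A i => nmem s A (neval s i)
  | NAdd e1 e2 => (neval s e1 + neval s e2)%N
  | NSub e1 e2 => (neval s e1 - neval s e2)%N
  | NMul e1 e2 => (neval s e1 * neval s e2)%N
  end.

Fixpoint reval (R : realType) (s : state R) (e : rexp) : R :=
  match e with
  | RConst n => n%:R
  | RRead A i => rmem s A (neval s i)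
  | RAdd e1 e2 => reval s e1 + reval s e2
  | RSub e1 e2 => reval s e1 - reval s e2
  | RMul e1 e2 => reval s e1 * reval s e2
  | RDiv e1 e2 => reval s e1 / reval s e2
  end.

Fixpoint beval (R : realType) (s : state R) (b : bexp) : bool :=
  match b with
  | BNLe e1 e2 => (neval s e1 <= neval s e2)%N
  | BNLt e1 e2 => (neval s e1 < neval s e2)%N
  | BRLe e1 e2 => reval s e1 <= reval s e2
  | BRLt e1 e2 => reval s e1 < reval s e2
  | BNot b1 => ~~ beval s b1
  | BAnd b1 b2 => beval s b1 && beval s b2
  end.

(* Every node of an expression costs one unit: besides the arithmetic
   operations and comparisons on reals, this charges for constants, memory
   accesses, index computations and Boolean connectives. *)
Fixpoint ncost (e : nexp) : nat :=
  match e with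
  | NConst _ => 1
  | NRead _ i => (ncost i).+1
  | NAdd e1 e2 | NSub e1 e2 | NMul e1 e2 => (ncost e1 + ncost e2).+1
  end.

Fixpoint rcost (e : rexp) : nat :=
  match e with
  | RConst _ => 1
  | RRead _ i => (ncost i).+1
  | RAdd e1 e2 | RSub e1 e2 | RMul e1 e2 | RDiv e1 e2 =>
      (rcost e1 + rcost e2).+1
  end.

Fixpoint bcost (b : bexp) : nat :=
  match b with
  | BNLe e1 e2 | BNLt e1 e2 => (ncost e1 + ncost e2).+1
  | BRLe e1 e2 | BRLt e1 e2 => (rcost e1 + rcost e2).+1
  | BNot b1 => (bcost b1).+1
  | BAnd b1 b2 => (bcost b1 + bcost b2).+1
  end.

(* [exec p s s' n]: started in state [s], the program [p] halts in state [s']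
   after [n] units of time. *)
Inductive exec (R : realType) : cmd -> state R -> state R -> nat -> Prop :=
| ExecSkip s : exec CSkip s s 1
| ExecNWrite s A i e :
    exec (CNWrite A i e) s
      (State (upd (nmem s) A (neval s i) (neval s e)) (rmem s))
      (ncost i + ncost e).+1
| ExecRWrite s A i e :
    exec (CRWrite A i e) s
      (State (nmem s) (upd (rmem s) A (neval s i) (reval s e)))
      (ncost i + rcost e).+1
| ExecSeq s1 s2 s3 p1 p2 n1 n2 :
    exec p1 s1 s2 n1 -> exec p2 s2 s3 n2 ->
    exec (CSeq p1 p2) s1 s3 (n1 + n2)
| ExecIfTrue s s' b p1 p2 n :
    beval s b -> exec p1 s s' n ->
    exec (CIf b p1 p2) s s' (bcost b + n).+1
| ExecIfFalse s s' b p1 p2 n :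
    ~~ beval s b -> exec p2 s s' n ->
    exec (CIf b p1 p2) s s' (bcost b + n).+1
| ExecWhileTrue s1 s2 s3 b p n1 n2 :
    beval s1 b -> exec p s1 s2 n1 -> exec (CWhile b p) s2 s3 n2 ->
    exec (CWhile b p) s1 s3 (bcost b + n1 + n2).+1
| ExecWhileFalse s b p :
    ~~ beval s b -> exec (CWhile b p) s s (bcost b).+1.

(* Initially, cell 0 of the natural arrays 0 and 1 holds t and k respectively,
   the real arrays 0 and 1 hold the endpoints and the values, and every other
   cell holds 0. *)
Definition input (R : realType) (a c : seq R) (k : nat) : state R :=
  State (fun A i => match A, i with
                    | 0%N, 0%N => size c
                    | 1%N, 0%N => k
                    | _, _ => 0%N
                    end)
        (fun A i => match A with
                    | 0%N => a`_i
                    | 1%N => c`_i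
                    | _ => 0
                    end).

(* On halting, cell 0 of the natural array 2 holds the number of pieces of the
   result, and the real arrays 2 and 3 hold its endpoints and its values. *)
Definition out_size (R : realType) (s : state R) : nat := nmem s 2 0.
Definition out_endpoints (R : realType) (s : state R) : seq R :=
  mkseq (rmem s 2) (out_size s).+1.
Definition out_values (R : realType) (s : state R) : seq R :=
  mkseq (rmem s 3) (out_size s).

(* Main.v *)
(** A function with at most [k] pieces splits the values c_1, ..., c_t into at
    most [k] blocks of consecutive values, and the best constant on a block is
    its midrange, with error half the oscillation. So twice the least error is
    the least [e] for which the values split into [k] blocks of oscillation at
    most [e]. The recursion opt(j+1, i) = min over l of
    max(opt(j, l), oscillation of c_(l+1), ..., c_i) computes it in time
    O(k t^2), as the oscillation is updated in constant time when [l]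
    decreases. No backtracking information is stored: once the optimal [e] is
    known, the greedy partition into maximal blocks of oscillation at most [e]
    uses the least number of blocks. *)

Require Import Defs.
From HB Require Import structures.
From mathcomp Require Import all_boot all_order all_algebra.
From mathcomp Require Import boolp classical_sets set_interval reals.
From mathcomp Require Import zify lra.

Set Implicit Arguments.
Unset Strict Implicit.
Unset Printing Implicit Defensive.

Import Order.TTheory GRing.Theory Num.Theory.

Local Open Scope classical_set_scope.
Local Open Scope ring_scope.

(** * Splitting a sequence into blocks of bounded oscillation *)

Section Blocks.
Variable R : realType.
Implicit Types (x : nat -> R) (e : R).

Definition block x e l i : Prop :=
  forall p q, (l <= p < i)%N -> (l <= q < i)%N -> x p - x q <= e.

(* The first [i] values split into at most [j] blocks; empty blocks are
   allowed, which makes the predicate monotone in [j]. *)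
Fixpoint fits x e j i : Prop :=
  if j is j'.+1 then exists2 l, (l <= i)%N & fits x e j' l /\ block x e l i
  else i = 0%N.

Lemma block_sub x e l i l' i' :
  (l <= l')%N -> (i' <= i)%N -> block x e l i -> block x e l' i'.
Proof. by move=> ll' ii' b p q hp hq; apply: b; lia. Qed.

Lemma block_le x e e' l i : e <= e' -> block x e l i -> block x e' l i.
Proof. by move=> ee' b p q hp hq; apply: le_trans (b _ _ hp hq) ee'. Qed.

Lemma fits0 x e j : fits x e j 0.
Proof. by elim: j => //= j IH; exists 0%N => //; split=> // p q; lia. Qed.

Lemma fitsS x e j i : fits x e j i -> fits x e j.+1 i.
Proof. by move=> h; exists i => //; split=> // p q; lia. Qed.

Lemma fits_leq x e j j' i : (j <= j')%N -> fits x e j i -> fits x e j' i.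
Proof.
move=> /subnK <-; elim: (j' - j)%N => // n IH h.
by rewrite addSn; apply: fitsS; apply: IH.
Qed.

Lemma fits_prefix x e j i i' : (i' <= i)%N -> fits x e j i -> fits x e j i'.
Proof.
elim: j i i' => [|j IH] i i' ii' /=; first by move=> h; lia.
case=> l li [fl bl]; exists (minn l i'); first by lia.
by split; [apply: IH fl; lia|move=> p q hp hq; apply: bl; lia].
Qed.

Lemma fits_le x e e' j i : e <= e' -> fits x e j i -> fits x e' j i.
Proof.
move=> ee'; elim: j i => //= j IH i [l li [fl bl]].
by exists l => //; split; [apply: IH|apply: block_le bl].
Qed.

Lemma fits_ge0 x e j i : (0 < i)%N -> fits x e j i -> 0 <= e.
Proof.
elim: j i => [|j IH] i i0 /=; first by lia.
case=> l li [fl bl]; case: (ltnP 0 l) => l0; first exact: IH fl.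
by have := bl 0%N 0%N; rewrite subrr; apply; lia.
Qed.

(** Both extrema are attained, so [mx - mn] is the exact oscillation; this is what makes
    [spans_block] an equivalence. *)
Definition spans x l i (mx mn : R) : Prop :=
  [/\ exists2 p, (l <= p < i)%N & mx = x p,
      exists2 p, (l <= p < i)%N & mn = x p &
      forall p, (l <= p < i)%N -> mn <= x p <= mx].

Lemma spans1 x i : spans x i i.+1 (x i) (x i).
Proof.
split; [exists i => //; lia|exists i => //; lia|move=> p hp].
have -> : p = i by lia.
by rewrite lexx.
Qed.

Lemma spans_block x e l i mx mn :
  spans x l i mx mn -> mx - mn <= e <-> block x e l i.
Proof.
case=> [[p hp ->] [q hq ->] h]; split; last by move=> b; apply: b.
move=> hpq p' q' hp' hq'.
by have := h _ hp'; have := h _ hq'; lra.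
Qed.

(** Covers growth to the left in the dynamic program and to the right in the greedy phase. The
    position [r] may already lie in the block, as in the first step of a cell. *)
Lemma spans_extend x l i l' i' mx mn r :
  spans x l i mx mn -> (l' <= l)%N -> (i <= i')%N -> (l' <= r < i')%N ->
  (forall p, (l' <= p < i')%N -> p = r \/ (l <= p < i)%N) ->
  spans x l' i' (Num.max mx (x r)) (Num.min mn (x r)).
Proof.
case=> [[p hp ->] [q hq ->] h] ll' ii' hr cov; split.
- by rewrite maxEle; case: ifP => _; [exists r|exists p => //; lia].
- by rewrite minEle; case: ifP => _; [exists q => //; lia|exists r].
- move=> s hs; rewrite ge_min le_max.
  case: (cov _ hs) => [->|/h/andP[-> ->]//]; by rewrite lexx !orbT.
Qed.

(* [d] is the optimum for [j] blocks, where the optimum for [j = 0] and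
   [i > 0] is infinite and therefore does not constrain [d]. *)
Definition optimal x j i (d : R) : Prop :=
  ((0 < j)%N || (i == 0)%N -> fits x d j i) /\
  forall e, 0 <= e -> fits x e j i -> d <= e.

(** The partial minimum of the recursion once all last blocks starting at [l] or later have been
    tried. For [j = 0] the only legal start is 0, so nothing has to be attained before [l] reaches
    0. *)
Definition optimal_from x j i l (d : R) : Prop :=
  ((0 < j)%N || (l == 0)%N -> fits x d j.+1 i) /\
  forall e l', 0 <= e -> (l <= l' <= i)%N ->
    fits x e j l' -> block x e l' i -> d <= e.

(** Starting the last block at [i] leaves it empty, so the entry of the previous round already is
    the value of the first candidate. *)
Lemma optimal_from_start x j i d :
  (0 < i)%N -> optimal x j i d -> optimal_from x j i i d.
Proof.
move=> i0 [h1 h2]; split=> [h|e l' e0 hl' f b].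
  by apply: fitsS; apply: h1.
by apply: h2 => //; have <- : l' = i by lia.
Qed.

Lemma optimal_from_end x j i d : optimal_from x j i 0 d -> optimal x j.+1 i d.
Proof.
move=> [h1 h2]; split=> [_|e e0 /= [l li [fl bl]]]; first by apply: h1; lia.
by apply: (h2 e l) => //; lia.
Qed.

(** For [j > 0] this is the minimum of [v] and [d]. For [j = 0] no candidate start beyond [l] is
    legal, so [d] carries no information and is overwritten. *)
Lemma optimal_from_step x j i l d dl mx mn :
  (l < i)%N -> optimal x j l dl -> spans x l i mx mn ->
  optimal_from x j i l.+1 d ->
  let v := Num.max (mx - mn) dl in
  optimal_from x j i l (if ~~ ((0 < j)%N && (d <= v)) then v else d).
Proof.
move=> li [o1 o2] sp [h1 h2] v; split=> [hj|e l' e0 hl' f b].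
  have fv : fits x v j.+1 i.
    exists l; first by lia.
    split; first by apply: fits_le (o1 hj); rewrite le_max lexx orbT.
    by apply/(spans_block _ sp); rewrite le_max lexx.
  case: ifP => // /negbFE/andP[j0 _]; apply: h1; lia.
have vd : l' = l -> v <= e.
  move=> ll; rewrite ll in f b; rewrite ge_max o2 // andbT.
  by apply/(spans_block _ sp).
have dd : (l < l')%N -> d <= e by move=> ll; apply: (h2 e l') => //; lia.
have j0 : (l < l')%N -> (0 < j)%N.
  by case: j f {o1 o2 h1 h2 vd dd} => //= f; lia.
have [ll|ll] := ltnP l l'.
  rewrite j0 //=; case: ifP => [|_]; last exact: dd.
  by rewrite -ltNge => /ltW vd'; apply: le_trans vd' (dd ll).
have {}vd := vd ltac:(lia).
by case: ifP => // /negbFE/andP[_ dv]; apply: le_trans dv vd.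
Qed.

(* A block that grew too long cannot lie inside one block of a partition into
   [m] blocks, so the last of these starts after position [l]. *)
Lemma not_fitsS x e m l i :
  (l < i)%N -> ~ fits x e m.-1 l.+1 -> ~ block x e l i -> (0 < m)%N ->
  ~ fits x e m i.
Proof.
case: m => //= m li nf nb _ [l' l'i [f b]].
have [h|h] := ltnP l l'; first by apply: nf; apply: fits_prefix f.
by apply: nb; apply: block_sub b.
Qed.

End Blocks.

(** * Total correctness with time bounds *)

Section TimedHoare.
Variable R : realType.
Implicit Types (s : state R) (Q : state R -> Prop).

Fixpoint loop_free (p : cmd) : bool :=
  match p with
  | CSeq p1 p2 | CIf _ p1 p2 => loop_free p1 && loop_free p2
  | CWhile _ _ => false
  | _ => true
  end.

(** Reduces the verification of straight-line code to computation. The value at [CWhile], here and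
    in [max_cost], is a dummy: [runs_run] assumes [loop_free]. *)
Fixpoint run (p : cmd) s : state R :=
  match p with
  | CNWrite A i e => State (upd (nmem s) A (neval s i) (neval s e)) (rmem s)
  | CRWrite A i e => State (nmem s) (upd (rmem s) A (neval s i) (reval s e))
  | CSeq p1 p2 => run p2 (run p1 s)
  | CIf b p1 p2 => if beval s b then run p1 s else run p2 s
  | _ => s
  end.

Fixpoint max_cost (p : cmd) : nat :=
  match p with
  | CSkip | CWhile _ _ => 1
  | CNWrite _ i e => (ncost i + ncost e).+1
  | CRWrite _ i e => (ncost i + rcost e).+1
  | CSeq p1 p2 => max_cost p1 + max_cost p2
  | CIf b p1 p2 => (bcost b + maxn (max_cost p1) (max_cost p2)).+1
  end.

Definition runs (p : cmd) s (N : nat) Q : Prop :=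
  exists s' n, [/\ exec p s s' n, (n <= N)%N & Q s'].

Lemma runs_run p s Q : loop_free p -> Q (run p s) -> runs p s (max_cost p) Q.
Proof.
move=> lf q; exists (run p s).
suff [n ex le] : exists2 n, exec p s (run p s) n & (n <= max_cost p)%N.
  by exists n.
elim: p s lf {q} => //=.
- by move=> s _; exists 1%N => //; constructor.
- by move=> A i e s _; eexists; [constructor|].
- by move=> A i e s _; eexists; [constructor|].
- move=> p1 IH1 p2 IH2 s /andP[/(IH1 s)[n1 e1 l1] /(IH2 (run p1 s))[n2 e2 l2]].
  by exists (n1 + n2)%N; [apply: ExecSeq e1 e2|lia].
- move=> b p1 IH1 p2 IH2 s /andP[/(IH1 s)[n1 e1 l1] /(IH2 s)[n2 e2 l2]].
  case: ifP => hb.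
    by exists (bcost b + n1).+1; [exact: ExecIfTrue|lia].
  by exists (bcost b + n2).+1; [apply: ExecIfFalse; rewrite ?hb|lia].
Qed.

Lemma runs_seq p1 p2 s N1 N2 Q Q' :
  runs p1 s N1 Q -> (forall s', Q s' -> runs p2 s' N2 Q') ->
  runs (CSeq p1 p2) s (N1 + N2) Q'.
Proof.
move=> [s1 [n1 [e1 l1 /[swap] h /h [s2 [n2 [e2 l2 q2]]]]]].
by exists s2, (n1 + n2)%N; split=> //; [apply: ExecSeq e1 e2|lia].
Qed.

Lemma runs_weaken p s N N' Q Q' :
  (N <= N')%N -> (forall s', Q s' -> Q' s') -> runs p s N Q -> runs p s N' Q'.
Proof.
move=> NN' QQ' [s' [n [ex le q]]]; exists s', n.
by split=> //; [apply: leq_trans le NN'|apply: QQ'].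
Qed.

(** The index of the invariant is the number of iterations left, so it gives both termination and
    the time bound. *)
Lemma runs_while (I : nat -> state R -> Prop) b p N r s :
  (forall r s, I r.+1 s -> beval s b /\ runs p s N (I r)) ->
  (forall s, I 0%N s -> ~~ beval s b) -> I r s ->
  runs (CWhile b p) s (r * (N + bcost b).+1 + (bcost b).+1) (I 0%N).
Proof.
move=> hS h0; elim: r s => [|r IH] s hI.
  by exists s, (bcost b).+1; split=> //; apply: ExecWhileFalse; apply: h0.
have [hb [s1 [n1 [e1 l1 /IH [s2 [n2 [e2 l2 q2]]]]]]] := hS _ _ hI.
exists s2, (bcost b + n1 + n2).+1; split=> //; first exact: ExecWhileTrue e1 e2.
by lia.
Qed.

(** A skipped write amounts to writing back the old value. The state thus keeps one shape without
    case analysis, and the written value becomes a [Num.max] or [Num.min]. *)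
Lemma run_cond_write s b A i e :
  run (CIf b (CRWrite A i e) CSkip) s =
  State (nmem s) (upd (rmem s) A (neval s i)
    (if beval s b then reval s e else rmem s A (neval s i))).
Proof.
rewrite /=; case: ifP => // _; case: s => nm rm /=; congr State.
apply/funext => B; apply/funext => j; rewrite /upd.
by case: ifP => // /andP[/eqP-> /eqP->].
Qed.

End TimedHoare.

(** * The program *)

Local Notation "p ;; q" := (CSeq p q) (at level 90, right associativity).

Section Program.
(* Scalars: the naturals [j] (completed rounds), [i] and [l], and the reals
   [hi] and [lo] (extrema of the current block) and [v]. Array [opt] holds
   opt(j, i) for all [i]; as [i] decreases during a round, the entries below
   [i] still belong to the previous round. *)
Local Notation nvar A := (NRead A (NConst 0)).
Local Notation rvar A := (RRead A (NConst 0)).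
Local Notation set_n A e := (CNWrite A (NConst 0) e).
Local Notation set_r A e := (CRWrite A (NConst 0) e).

Local Notation t := (nvar 0).
Local Notation k := (nvar 1).
Local Notation j := (nvar 3).
Local Notation i := (nvar 4).
Local Notation l := (nvar 5).
Local Notation opt := 4%N.
Local Notation hi := (rvar 5).
Local Notation lo := (rvar 6).
Local Notation v := (rvar 7).
Local Notation pred_n e := (NSub e (NConst 1)).
Local Notation succ_n e := (NAdd e (NConst 1)).

Definition raise A e := CIf (BRLt (rvar A) e) (set_r A e) CSkip.
Definition lower A e := CIf (BRLt e (rvar A)) (set_r A e) CSkip.

(* In round 0 the entries below [i] are still 0 and every [v] overwrites the
   entry at [i], which ends as the oscillation of the first [i] values. *)
Definition relax : cmd :=
  set_n 5 (pred_n l) ;;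
  raise 5 (RRead 1 l) ;;
  lower 6 (RRead 1 l) ;;
  set_r 7 (RSub hi lo) ;;
  raise 7 (RRead opt l) ;;
  CIf (BNot (BAnd (BNLt (NConst 0) j) (BRLe (RRead opt i) v)))
    (CRWrite opt i v) CSkip.

Definition start_cell : cmd :=
  set_n 5 i ;;
  set_r 5 (RRead 1 (pred_n i)) ;;
  set_r 6 (RRead 1 (pred_n i)).

Definition cell : cmd :=
  start_cell ;; CWhile (BNLt (NConst 0) l) relax ;; set_n 4 (pred_n i).

Definition round : cmd :=
  set_n 4 t ;; CWhile (BNLt (NConst 0) i) cell ;; set_n 3 (succ_n j).

Definition optimize : cmd := CWhile (BNLt j k) round.

Definition greedy_start : cmd :=
  set_n 4 (NConst 1) ;;
  set_n 2 (NConst 1) ;;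
  CRWrite 2 (NConst 0) (RRead 0 (NConst 0)) ;;
  CRWrite 2 (NConst 1) (RRead 0 (NConst 1)) ;;
  CRWrite 3 (NConst 0) (RRead 1 (NConst 0)) ;;
  set_r 5 (RRead 1 (NConst 0)) ;;
  set_r 6 (RRead 1 (NConst 0)).

(** The value and right endpoint of the last block are rewritten at each step, so the output arrays
    always describe a complete approximation of the values read so far. *)
Definition greedy_step : cmd :=
  set_r 7 (RRead 1 i) ;;
  raise 5 v ;;
  lower 6 v ;;
  CIf (BRLt (RRead opt t) (RSub hi lo))
    (set_n 2 (succ_n (nvar 2)) ;; set_r 5 v ;; set_r 6 v) CSkip ;;
  CRWrite 3 (pred_n (nvar 2)) (RDiv (RAdd hi lo) (RConst 2)) ;;
  set_n 4 (succ_n i) ;;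
  CRWrite 2 (nvar 2) (RRead 0 i).

Definition greedy : cmd :=
  greedy_start ;; CWhile (BNLt i t) greedy_step.

Definition approximate : cmd := optimize ;; greedy.

End Program.

(** * Invariants and running time of the two phases *)

Section Correctness.
Variables (R : realType) (a c : seq R) (k : nat).
Implicit Types s : state R.
Let t := size c.
Let x := nth 0 c.

Lemma run_seq p q s : run (p ;; q) s = run q (run p s).
Proof. by []. Qed.

Lemma run_raise s A e :
  run (raise A e) s = State (nmem s)
    (upd (rmem s) A 0%N (Num.max (rmem s A 0%N) (reval s e))).
Proof. by rewrite run_cond_write maxElt. Qed.

Lemma run_lower s A e :
  run (lower A e) s = State (nmem s)
    (upd (rmem s) A 0%N (Num.min (rmem s A 0%N) (reval s e))).
Proof. by rewrite run_cond_write minC minElt. Qed.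

Definition input_intact s : Prop :=
  [/\ nmem s 0 0 = t, nmem s 1 0 = k, rmem s 0 = nth 0 a & rmem s 1 = x].

Definition round_inv j i s : Prop :=
  [/\ input_intact s, nmem s 3 0 = j, nmem s 4 0 = i /\ (i <= t)%N,
    forall l, (l <= i)%N -> optimal x j l (rmem s 4 l) &
    forall l, (i < l <= t)%N -> optimal x j.+1 l (rmem s 4 l)].

(** At [l = i] the last block is empty and has no extrema; [hi] and [lo] then hold the value at
    [i.-1], whence [minn l i.-1]. *)
Definition cell_inv j i l s : Prop :=
  [/\ input_intact s,
    [/\ nmem s 3 0 = j, nmem s 4 0 = i, nmem s 5 0 = l & (l <= i <= t)%N],
    spans x (minn l i.-1) i (rmem s 5 0) (rmem s 6 0),
    optimal_from x j i l (rmem s 4 i) &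
    (forall l, (l < i)%N -> optimal x j l (rmem s 4 l)) /\
    (forall l, (i < l <= t)%N -> optimal x j.+1 l (rmem s 4 l))].


Lemma relax_inv j i l s :
  cell_inv j i l.+1 s -> cell_inv j i l (run relax s).
Proof.
move=> [[t0 k0 a0 x0] [j0 i1 l1 li] sp o [lo hi]].
have sp' := spans_extend (l' := l) (i' := i) (r := l) sp ltac:(lia) ltac:(lia)
  ltac:(lia) ltac:(lia).
have li' : (l < i)%N by lia.
have o' := optimal_from_step li' (lo l li') sp' o.
rewrite /relax !run_seq run_raise run_lower.
rewrite run_raise run_cond_write /= /upd /= i1 j0 l1 subn1 /= x0.
split=> //=.
- by split=> //; lia.
- by rewrite (_ : minn l i.-1 = l) //; lia.
- by rewrite eqxx.
- split=> m hm; first by rewrite ltn_eqF //; apply: lo.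
  by rewrite gtn_eqF; [apply: hi|lia].
Qed.

Lemma start_cell_inv j i s :
  round_inv j i.+1 s -> cell_inv j i.+1 i.+1 (run start_cell s).
Proof.
move=> [[t0 k0 a0 x0] j0 [i1 it] lo hi].
rewrite /start_cell !run_seq /= /upd /= i1 subn1 /= x0; split=> //=.
- by split=> //; lia.
- by rewrite (_ : minn i.+1 i = i); [exact: spans1|lia].
- by apply: optimal_from_start => //; apply: lo.
- by split=> l hl; [apply: lo; lia|apply: hi].
Qed.

Lemma end_cell_inv j i s :
  cell_inv j i.+1 0 s -> round_inv j i (run (CNWrite 4 (NConst 0)
    (NSub (NRead 4 (NConst 0)) (NConst 1))) s).
Proof.
move=> [[t0 k0 a0 x0] [j0 i1 l1 li] sp o [lo hi]].
rewrite /= /upd /= i1 subn1 /=; split=> //=; first by split=> //; lia.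
move=> l /andP[il lt]; have [->|ne] := eqVneq l i.+1.
  exact: optimal_from_end.
by apply: hi; lia.
Qed.

Hypothesis t_gt0 : (0 < t)%N.

(** At most [t] iterations of constant cost. The constant is rounded up to absorb the code around
    the loop, using [t > 0]; the later bounds are obtained likewise. *)
Lemma runs_cell j i s : round_inv j i.+1 s -> runs cell s (110 * t) (round_inv j i).
Proof.
move=> ri; have it : (i < t)%N by case: ri => _ _ [].
apply: (@runs_weaken _ _ _ (max_cost start_cell + _) _ _ _ _ (fun _ => id));
  last first.
  apply: runs_seq (runs_run (Q := cell_inv j i.+1 i.+1) _ (start_cell_inv ri)) _.
    by [].
  move=> s1 c1; apply: (runs_seq (Q := cell_inv j i.+1 0)).
    apply: (runs_while (N := max_cost relax)) c1 => [r s2 c2|s2].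
      split; first by case: c2 => _ [_ _ /= -> _].
      by apply: runs_run => //; apply: relax_inv.
    by case=> _ [_ _ /= -> _].
  move=> s2 c2; apply: runs_run => //; exact: end_cell_inv.
rewrite /=; lia.
Qed.

Definition optimize_inv j s : Prop :=
  [/\ input_intact s, nmem s 3 0 = j &
    forall l, (l <= t)%N -> optimal x j l (rmem s 4 l)].

Lemma runs_round j s :
  optimize_inv j s -> runs round s (200 * t ^ 2) (optimize_inv j.+1).
Proof.
move=> [ii j0 o].
apply: (@runs_weaken _ _ _ _ _ _ _ _ (fun _ => id)); last first.
  apply: (runs_seq (Q := round_inv j t)).
    apply: runs_run => //=; rewrite /upd /=.
    case: ii => t0 k0 a0 x0; split=> //=.
    by move=> l; lia.
  move=> s1 c1; apply: (runs_seq (Q := round_inv j 0)).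
    apply: (runs_while (N := 110 * t)) c1 => [r s2 c2|s2].
      split; first by case: c2 => _ _ [/= -> _].
      exact: runs_cell.
    by case=> _ _ [/= -> _].
  move=> s2 [[t0 k0 a0 x0] j2 _ lo hi]; apply: runs_run => //=.
  rewrite /upd /=; split=> //=; first by rewrite j2 addn1.
  case=> [|l] hl; last exact: hi.
  (* The loop never visits entry 0. The empty prefix fits for every bound, so the old entry stays
     optimal. *)
  have [_ h] := lo 0%N (leqnn _).
  by split=> [_|e e0 _]; [apply: fits0|apply: h => //; apply: fits0].
rewrite /=; nia.
Qed.

Lemma runs_optimize s :
  optimize_inv 0 s -> runs optimize s (300 * (k * t ^ 2) + 10) (optimize_inv k).
Proof.
move=> oi.
pose I r s := (r <= k)%N /\ optimize_inv (k - r) s.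
apply: (@runs_weaken _ _ _ _ _ (I 0%N)); last first.
- apply: (runs_while (I := I) (N := 200 * t ^ 2) (r := k)).
  + move=> r s1 [rk c1]; split.
      by case: c1 => [[_ k0 _ _] j0 _] /=; rewrite j0 k0; lia.
    apply: runs_weaken (runs_round c1) => // s2.
    by rewrite -subSn // subSS => ?; split=> //; lia.
  + by move=> s1 [_ [[_ k0 _ _] j0 _]] /=; rewrite j0 k0; lia.
  + by split=> //; rewrite subnn.
- by move=> s1 []; rewrite subn0.
- rewrite /=; nia.
Qed.

(** [b] lists the block boundaries as indices. The last clause certifies that [m] is minimal: the
    values up to the first one of the last block already need [m] blocks. It does not mention [i],
    so it survives the growth of that block. *)
Definition greedy_partition e i m (u w : nat -> R) mx mn : Prop :=
  exists b : nat -> nat,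
    [/\ [/\ (0 < m)%N, b 0%N = 0%N, b m = i &
          forall q, (q < m)%N -> (b q < b q.+1)%N],
        forall q, (q <= m)%N -> u q = a`_(b q),
        forall q p, (q < m)%N -> (b q <= p < b q.+1)%N -> `|x p - w q| <= e / 2,
        spans x (b m.-1) i mx mn /\ mx - mn <= e &
        ~ fits x e m.-1 (b m.-1).+1].

Lemma spans_center e l i mx mn p :
  spans x l i mx mn -> mx - mn <= e -> (l <= p < i)%N ->
  `|x p - (mx + mn) / 2| <= e / 2.
Proof. by move=> [_ _ h] le /h; rewrite ler_norml; lra. Qed.

Lemma greedy_extend e i m u w mx mn u' w' mx' mn' :
  greedy_partition e i m u w mx mn ->
  mx' = Num.max mx (x i) -> mn' = Num.min mn (x i) -> mx' - mn' <= e ->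
  (forall q, u' q = if q == m then a`_i.+1 else u q) ->
  (forall q, w' q = if q == m.-1 then (mx' + mn') / 2 else w q) ->
  greedy_partition e i.+1 m u' w' mx' mn'.
Proof.
move=> [b [[m0 b0 bm bS] ub wb [sp _] nf]] emx emn le u'E w'E.
have bi : (b m.-1 < i)%N by rewrite -bm -{2}(prednK m0) bS //; lia.
have sp' : spans x (b m.-1) i.+1 mx' mn'.
  by rewrite emx emn; apply: spans_extend sp _ _ _ _ => //; lia.
exists (fun q => if q == m then i.+1 else b q).
rewrite [m.-1 == m]ltn_eqF; last by lia.
split=> //.
- split=> //; [by rewrite ifN //; lia|by rewrite eqxx|move=> q qm].
  rewrite ltn_eqF //; case: eqP => [e1|_]; last exact: bS.
  by have := bS _ qm; rewrite e1 bm; lia.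
- by move=> q qm; rewrite u'E; case: ifP => // ne; apply: ub.
- move=> q p qm; rewrite w'E ltn_eqF //.
  case: (q =P m.-1) => [e1|ne].
    have -> : q.+1 == m by lia.
    by rewrite e1 => hp; apply: spans_center sp' le hp.
  by rewrite ifN; [apply: wb|lia].
Qed.

Lemma greedy_new e i m u w mx mn u' w' :
  greedy_partition e i m u w mx mn -> 0 <= e ->
  e < Num.max mx (x i) - Num.min mn (x i) ->
  (forall q, u' q = if q == m.+1 then a`_i.+1 else u q) ->
  (forall q, w' q = if q == m then (x i + x i) / 2 else w q) ->
  greedy_partition e i.+1 m.+1 u' w' (x i) (x i).
Proof.
move=> [b [[m0 b0 bm bS] ub wb [sp _] nf]] e0 lt u'E w'E.
have bi : (b m.-1 < i)%N by rewrite -bm -{2}(prednK m0) bS //; lia.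
have sp' : spans x (b m.-1) i.+1 (Num.max mx (x i)) (Num.min mn (x i)).
  by apply: spans_extend sp _ _ _ _ => //; lia.
exists (fun q => if q == m.+1 then i.+1 else b q).
rewrite [m.+1.-1 == m.+1]ltn_eqF //= bm.
split=> //.
- split=> //; [by rewrite eqxx|move=> q qm].
  rewrite ltn_eqF // eqSS; case: eqP => [->|ne]; first by rewrite bm.
  by apply: bS; lia.
- by move=> q qm; rewrite u'E; case: ifP => // ne; apply: ub; lia.
- move=> q p qm; rewrite w'E ltn_eqF // eqSS.
  case: (q =P m) => [->|ne]; last by apply: wb; lia.
  rewrite bm => hp; apply: spans_center (spans1 _ _) _ hp; lra.
- by split; [exact: spans1|lra].
(* The new block starts at [i]; its certificate follows from the old one and from the old block
   exceeding oscillation [e] once it includes [i]. *)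
- apply: not_fitsS nf _ m0; first by lia.
  by move/(spans_block _ sp'); lra.
Qed.

Definition greedy_inv e i s : Prop :=
  [/\ input_intact s, rmem s 4 t = e, nmem s 4 0 = i /\ (i <= t)%N &
    greedy_partition e i (nmem s 2 0) (rmem s 2) (rmem s 3)
      (rmem s 5 0) (rmem s 6 0)].

Lemma greedy_start_inv e s :
  input_intact s -> rmem s 4 t = e -> 0 <= e ->
  greedy_inv e 1 (run greedy_start s).
Proof.
move=> [t0 k0 a0 x0] et e0.
rewrite /greedy_start !run_seq /= /upd /= a0 x0; split=> //=.
exists id; split=> //=.
- by case=> [|[]].
- by move=> [|//] p _ hp; rewrite (_ : p = 0%N) /= ?subrr ?normr0; [lra|lia].
- by split; [exact: spans1|lra].
Qed.

Lemma greedy_step_inv e i s :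
  0 <= e -> (i < t)%N -> greedy_inv e i s -> greedy_inv e i.+1 (run greedy_step s).
Proof.
move=> e0 it [[t0 k0 a0 x0] et [i0 _] gp].
have m0 : (0 < nmem s 2 0)%N by case: gp => b [[]].
rewrite /greedy_step !run_seq run_raise run_lower /= /upd /= t0 i0 et x0.
case: ltP => hc; rewrite /= i0 a0 ?addn1 ?addnK ?subn1; split=> //=.
- exact: (greedy_new gp e0 hc).
- exact: (greedy_extend gp).
Qed.

Lemma runs_greedy e s :
  input_intact s -> rmem s 4 t = e -> 0 <= e ->
  runs greedy s (200 * t) (greedy_inv e t).
Proof.
move=> ii et e0; pose I r s := (r < t)%N /\ greedy_inv e (t - r) s.
apply: (@runs_weaken _ _ _ _ _ (I 0%N)); last first.
- apply: runs_seq (runs_run (Q := I t.-1) _ _) _ => //.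
    split; first by lia.
    rewrite (_ : t - t.-1 = 1)%N; first exact: greedy_start_inv.
    by lia.
  move=> s1; apply: (runs_while (N := max_cost greedy_step)) => [r s2|s2].
    move=> [rt g2]; split.
      by case: g2 => [[t0 _ _ _] _ [i0 _] _] /=; rewrite t0 i0; lia.
    apply: runs_run => //; split; first by lia.
    rewrite (_ : t - r = (t - r.+1).+1)%N; last by lia.
    by apply: greedy_step_inv => //; lia.
  by case=> _ [[t0 _ _ _] _ [i0 _] _] /=; rewrite t0 i0; lia.
- by move=> s1 []; rewrite subn0.
- rewrite /=; nia.
Qed.

Lemma runs_approximate :
  (0 < k)%N -> runs approximate (input a c k) (600 * (k * t ^ 2)) (fun s =>
    exists2 e, optimal x k t e & greedy_inv e t s).
Proof.
move=> k0; apply: (@runs_weaken _ _ _ _ _ _ _ _ (fun _ => id)); last first.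
  apply: (runs_seq (Q := optimize_inv k)).
    (* Zeroed memory is a correct table for [j = 0]: an entry with [l > 0] has to be attained by no
       partition, and 0 is below every admissible bound. *)
    apply: runs_optimize; split=> // l _; split=> [/eqP->|//]; exact: fits0.
  move=> s [ii _ o]; have [f _] := o t (leqnn t).
  apply: runs_weaken (runs_greedy ii erefl _) => [//|s' gi|].
    by exists (rmem s 4 t) => //; apply: o.
  by apply: fits_ge0 (f _); rewrite ?k0.
rewrite /=; nia.
Qed.

End Correctness.

(** * From piecewise-constant functions to blocks of values *)

Section Approximation.
Variable R : realType.
Implicit Types (a c : seq R) (f g h : R -> R) (I : set R).

(** Stated for any order: it serves for endpoints in [R] and for block boundaries in [nat]. *)
Lemma segment_exists d (T : orderType d) (u : nat -> T) n r :
  (u 0%N <= r < u n)%O -> exists2 q, (q < n)%N & (u q <= r < u q.+1)%O.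
Proof.
elim: n => [|n IH] /andP[u0 un]; first by have := le_lt_trans u0 un; rewrite ltxx.
have [run|nru] := ltP r (u n); last by exists n => //; rewrite nru.
by have [|q qn hq] := IH; [rewrite u0|exists q; [apply: ltnW|]].
Qed.

Lemma itv_convex (J : interval R) x y z :
  x \in J -> z \in J -> x <= y <= z -> y \in J.
Proof.
case: J => bl br; rewrite !itv_boundlr => /andP[hx _] /andP[_ hz] /andP[xy yz].
by rewrite (le_trans hx) ?(le_trans _ hz) ?bnd_simp.
Qed.

Lemma sorted_nth_lt a i j :
  sorted <%R a -> (i < j < size a)%N -> a`_i < a`_j.
Proof.
move=> sa hij; apply: (sorted_ltn_nth lt_trans 0 sa); rewrite ?inE;
  move: hij => /andP[ij jn] //; exact: ltn_trans jn.
Qed.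

Lemma sorted_nth_le a i j :
  sorted <%R a -> (i <= j < size a)%N -> a`_i <= a`_j.
Proof.
move=> sa; rewrite leq_eqVlt => /andP[/orP[/eqP->//|ij] ja].
by apply: ltW; apply: sorted_nth_lt; rewrite ?ij.
Qed.

Lemma mem_domain a n r :
  size a = n.+1 -> domain a r <-> a`_0 <= r < a`_n.
Proof.
by move=> sa; rewrite /domain /= in_itv /= nth0 -[n in a`_n]/n.+1.-1 -sa nth_last;
  case: a sa.
Qed.

Lemma domain_segment a n r : size a = n.+1 -> domain a r ->
  exists2 p, (p < n)%N & a`_p <= r < a`_p.+1.
Proof. by move=> sa /(mem_domain _ sa); apply: segment_exists. Qed.

Lemma segment_domain a n p r :
  size a = n.+1 -> sorted <%R a -> (p < n)%N -> a`_p <= r < a`_p.+1 ->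
  domain a r.
Proof.
move=> sz sa pn /andP[h1 h2]; apply/(mem_domain _ sz).
rewrite (le_trans _ h1) ?(lt_le_trans h2) ?sorted_nth_le //; lia.
Qed.

Lemma segment_unique a p q r :
  sorted <%R a -> (p.+1 < size a)%N -> (q.+1 < size a)%N ->
  a`_p <= r < a`_p.+1 -> a`_q <= r < a`_q.+1 -> p = q.
Proof.
have leq_pq p' q' : sorted <%R a -> (p'.+1 < size a)%N -> (q'.+1 < size a)%N ->
    a`_p' <= r < a`_p'.+1 -> a`_q' <= r < a`_q'.+1 -> (p' <= q')%N.
  move=> sa pa qa /andP[h1 _] /andP[_ h2]; rewrite leqNgt; apply/negP => qp.
  have := sorted_nth_le (i := q'.+1) (j := p') sa; rewrite leNgt.
  by rewrite (le_lt_trans h1 h2) => /(_ ltac:(lia)).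
by move=> sa pa qa hp hq; apply/eqP; rewrite eqn_leq; apply/andP;
  split; apply: leq_pq.
Qed.

Lemma specifies_exists a c :
  (0 < size c)%N -> size a = (size c).+1 -> sorted <%R a ->
  exists f, specifies a c f.
Proof.
move=> c0 sz sa.
have /choice[f fP] : forall r, exists v, forall i, (i < size c)%N ->
    a`_i <= r < a`_i.+1 -> v = c`_i.
  move=> r; have [[p pc hp]|no] :=
    pselect (exists2 p, (p < size c)%N & a`_p <= r < a`_p.+1).
    exists c`_p => i ic hi; congr nth.
    by apply: (segment_unique sa) hp hi; rewrite sz ltnS.
  by exists 0 => i ic hi; case: no; exists i.
by exists f; split=> // i ic r; apply: fP.
Qed.

Lemma specifies_piecewise a c f :
  specifies a c f -> piecewise_constant (domain a) (size c) f.
Proof.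
move=> [c0 sz sa fE].
exists (size c), (fun i => `[a`_i, a`_i.+1[); split=> //.
- split.
  + apply/seteqP; split=> r.
      by move=> [i _ /=]; rewrite in_itv /=; apply: segment_domain (ltn_ord i).
    move=> /(domain_segment sz)[p pc hp].
    by exists (Ordinal pc) => //=; rewrite in_itv.
  + move=> i j _ _ [r [/=]]; rewrite !in_itv /= => hi hj; apply: val_inj.
    by apply: (segment_unique sa) hi hj; rewrite sz ltnS.
  + move=> i _; exists a`_i; rewrite /= in_itv /= lexx.
    by apply: sorted_nth_lt => //; rewrite sz !ltnS leqnn /=.
- by move=> i; exists c`_i => r; rewrite in_itv; apply: fE.
Qed.

Lemma piecewise_constant_leq I k k' g :
  (k <= k')%N -> piecewise_constant I k g -> piecewise_constant I k' g.
Proof.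
by move=> kk' [m [J [mk p v]]]; exists m, J; split=> //; apply: leq_trans kk'.
Qed.

(** Ensures that the [sup] in [supdist] is a genuine upper bound rather than a default value. *)
Lemma piecewise_constant_bounded I k g :
  piecewise_constant I k g -> exists B, forall r, I r -> `|g r| <= B.
Proof.
move=> [m [J [_ [<- _ _] /choice[v vE]]]].
exists (\sum_i `|v i|) => r [i _ /= ri].
by rewrite (vE i) // (bigD1 i) //= lerDl sumr_ge0.
Qed.

Lemma le_supdist I k k' f g r :
  piecewise_constant I k f -> piecewise_constant I k' g -> I r ->
  `|f r - g r| <= supdist I f g.
Proof.
move=> /piecewise_constant_bounded[B fB] /piecewise_constant_bounded[B' gB] Ir.
apply: ub_le_sup; last by exists r.
exists (B + B') => _ [s Is <-].
by apply: le_trans (ler_normB _ _) _; rewrite lerD ?fB ?gB.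
Qed.

(* Reading off the pieces which contain the left endpoints [a`_p] turns the
   partition of the domain into a partition of the values into blocks. *)
Lemma piecewise_constant_fits a c f g k :
  specifies a c f -> piecewise_constant (domain a) k g ->
  fits (nth 0 c) (2 * supdist (domain a) f g) k (size c).
Proof.
move=> sp pg; have [c0 sz sa fE] := sp.
set d := supdist _ _ _.
have close p : (p < size c)%N -> `|c`_p - g a`_p| <= d.
  move=> pc; have hp : a`_p <= a`_p < a`_p.+1.
    by rewrite lexx sorted_nth_lt // sz !ltnS leqnn.
  rewrite -(fE p pc _ hp); apply: le_supdist (specifies_piecewise sp) pg _.
  exact: segment_domain sz sa pc hp.
have [m [J [mk [Jc Jt _] Jv]]] := pg.
have piece p : exists i, (p < size c)%N -> a`_p \in J i.
  have mem q : (q < size c)%N -> exists i, a`_q \in J i.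
    move=> qc; have : domain a a`_q.
      apply: (segment_domain sz sa qc).
      by rewrite lexx sorted_nth_lt // sz !ltnS leqnn.
    by rewrite -Jc => -[i _ hi]; exists i.
  have [pc|pc] := ltnP p (size c); first by have [i hi] := mem p pc; exists i.
  by have [i _] := mem 0%N c0; exists i => pc'; lia.
have [pi piE] := choice piece.
(* Pieces are intervals, so the left endpoints in one piece have consecutive indices. *)
have convex p q r : (p <= q <= r)%N -> (r < size c)%N -> pi p = pi r -> pi q = pi r.
  move=> pqr rc epr; apply: Jt => //; exists a`_q; split=> /=.
    by apply: piE; lia.
  apply: (itv_convex (x := a`_p) (z := a`_r)).
  - by rewrite /= -epr; apply: piE; lia.
  - exact: piE.
  - by rewrite !sorted_nth_le // sz; lia.
pose used i := map pi (iota 0 i).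
(* The induction counts the distinct pieces met by the first [i] left endpoints. *)
suff fitsP i : (i <= size c)%N -> fits (nth 0 c) (2 * d) #|used i| i.
  apply: fits_leq (fitsP _ (leqnn _)); apply: leq_trans mk.
  by rewrite -[leqRHS]card_ord max_card.
elim/ltn_ind: i => -[|i] IH ic; first exact: fits0.
have exi : exists l, pi l == pi i by exists i.
(* The last block starts at the first index whose piece is that of [i]. The prefix before it misses
   this piece, so its count is strictly smaller. *)
set l := ex_minn exi.
have [/eqP pl lmin] : pi l == pi i /\ forall q, pi q == pi i -> (l <= q)%N.
  by rewrite /l; case: ex_minnP.
have li : (l <= i)%N := lmin i (eqxx _).
have lt : (#|used l| < #|used i.+1|)%N.
  apply: proper_card; apply/properP; split.
    apply/fintype.subsetP => _ /mapP[p pl' ->]; apply: map_f.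
    by move: pl'; rewrite !mem_iota; lia.
  exists (pi i); first by apply: map_f; rewrite mem_iota; lia.
  apply/negP => /mapP[p]; rewrite mem_iota => pl' /esym/eqP/lmin; lia.
apply: fits_leq lt _; exists l; first by lia.
split; first by apply: IH; lia.
move=> p q hp hq.
have e1 : pi p = pi i by apply: (convex l) => //; lia.
have e2 : pi q = pi i by apply: (convex l) => //; lia.
have [v gv] := Jv (pi i).
have := close p ltac:(lia); have := close q ltac:(lia).
rewrite !gv -?e1 ?piE ?ler_norml; try lia; last by rewrite e1 -e2 piE //; lia.
lra.
Qed.

End Approximation.

(** * Optimality of the computed approximation *)

Theorem mainTheorem4 (R : realType) :
  exists (P : cmd) (C : nat),
    forall (k : nat) (a c : seq R) (f : R -> R),
      (1 <= k)%N -> specifies a c f ->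
      exists (s : state R) (n : nat) (g : R -> R),
        [/\ exec P (input a c k) s n,
            (n <= C * (k * size c ^ 2))%N,
            [/\ specifies (out_endpoints s) (out_values s) g,
                domain (out_endpoints s) = domain a &
                (size (out_values s) <= k)%N],
            piecewise_constant (domain a) k g &
            forall h : R -> R, piecewise_constant (domain a) k h ->
              supdist (domain a) f g <= supdist (domain a) f h].
Proof.
exists approximate, 600%N => k a c f k0 sp.
have [c0 sz sa fE] := sp.
have [s [n [ex le [e [opt1 opt2] [_ _ _]]]]] := runs_approximate a c0 k0.
set m := nmem s 2 0; move=> [b [[m0 b0 bm bS] ub wb [spn _] nf]].
have {opt1} fk := opt1 ltac:(by rewrite k0).
have bmono p q : (p <= q <= m)%N -> (b p <= b q)%N.
  move=> /andP[pq]; rewrite -(subnKC pq); elim: (q - p)%N => [|r IH] hr.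
    by rewrite addn0.
  by apply: leq_trans (IH _) _; [lia|rewrite addnS; apply/ltnW/bS; lia].
have bt q : (q <= m)%N -> (b q <= size c)%N.
  by move=> qm; rewrite -bm; apply: bmono; rewrite qm leqnn.
have endE q : (q <= m)%N -> (out_endpoints s)`_q = a`_(b q).
  by move=> qm; rewrite nth_mkseq ?ltnS // ub.
have szv : size (out_values s) = m by rewrite size_mkseq.
have sze : size (out_endpoints s) = m.+1 by rewrite size_mkseq.
have se : sorted <%R (out_endpoints s).
  apply/(sortedP 0) => q; rewrite sze ltnS => qm.
  rewrite !endE //; last exact: ltnW.
  by apply: sorted_nth_lt; rewrite ?sz // bS // ltnS bt.
have dE : domain (out_endpoints s) = domain a.
  apply/funext => r; apply/propext.
  by rewrite (mem_domain _ sze) (mem_domain _ sz) !endE // b0 bm.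
have mk : (m <= k)%N.
  (* If [k < m], the optimal split into [k] blocks, restricted to a prefix, contradicts the
     minimality certificate. *)
  rewrite leqNgt; apply/negP => km; apply: nf.
  apply: (fits_prefix (i := size c)); last by apply: fits_leq fk; lia.
  by rewrite -bm -{2}(prednK m0) bS //; lia.
have [g gs] : exists g, specifies (out_endpoints s) (out_values s) g.
  by apply: specifies_exists; rewrite ?szv.
have pg : piecewise_constant (domain a) k g.
  by have := specifies_piecewise gs; rewrite dE szv; apply: piecewise_constant_leq.
exists s, n, g; split=> //; first by rewrite szv.
(* The output stays within [e / 2] of [f], while any competitor [h] yields a split of oscillation
   twice its distance, which is at least the optimum [e]. *)
move=> h ph; apply: (@le_trans _ _ (e / 2)).
  apply: ge_sup.
    exists `|f a`_0 - g a`_0|; exists a`_0 => //.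
    apply: (segment_domain sz sa c0).
    by rewrite lexx sorted_nth_lt // sz.
  move=> _ [r /(domain_segment sz)[p pc hp] <-].
  (* The block [q] containing index [p] gives the output piece containing [r]. *)
  have [|q qm hq] := @segment_exists _ nat b m p; first by rewrite b0 bm.
  have [_ _ _ gE] := gs.
  rewrite (fE p pc r hp) (gE q) ?szv //; first by rewrite nth_mkseq //; apply: wb.
  have [/andP[h1 h2] /andP[h3 h4]] := (hp, hq : (b q <= p < b q.+1)%N).
  rewrite !endE ?(ltnW qm) //; apply/andP; split.
    by apply: le_trans h1; apply: sorted_nth_le; rewrite ?sz //; lia.
  by apply: lt_le_trans h2 _; apply: sorted_nth_le; rewrite ?sz ?h4 //= ltnS bt.
have d0 : 0 <= 2 * supdist (domain a) f h.
  exact: fits_ge0 (piecewise_constant_fits sp ph).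
have := opt2 _ d0 (piecewise_constant_fits sp ph); lra.
Qed.
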